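(* Let $n=2$, let $\mathsf{L}\colon \mathsf{K}^2\times[0,1]^2\to\mathsf{K}$, and assume that $\prec$ is compatible with $\oplus$. The following monotonicity condition holds: for all $\mathbf{X},\mathbf{Z}\in\mathsf{K}^2$ with $\mathbf{X}\preceq_{(2)}\mathbf{Z}$, $\mathcal{C}_{\preceq,\sigma,\mathsf{L}}(\mathbf{X},\mu)\preceq\mathcal{C}_{\preceq,\tau,\mathsf{L}}(\mathbf{Z},\mu)$ for any $\sigma\in\Pi_{\mathbf{X}}$, $\tau\in\Pi_{\mathbf{Z}}$ and $\mu\in\mathbf{M}$, if and only if all of the following are satisfied: (a) the $\mathcal{C}_{\preceq}$-operator (with $n=2$) is well defined; (b) for any $\mathbf{v}\in\mathsf{K}$ and $b\in[0,1]$, the function $[\mathbf{0},\mathbf{v}]_{\mathsf{K}}\ni\mathbf{x}\mapsto \mathsf{L}(\mathbf{x},\mathbf{0},1,b)\oplus \mathsf{L}(\mathbf{v},\mathbf{x},b,0)$ is non-decreasing w.r.t. $\preceq$; (c) for any $\mathbf{u}\in\mathsf{K}$ and $b\in[0,1]$, the function $[\mathbf{u},\mathbf{1}]_{\mathsf{K}}\ni\mathbf{x}\mapsto \mathsf{L}(\mathbf{x},\mathbf{u},b,0)$ is non-decreasing w.r.t. $\preceq$.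
   Context: Setting: $\mathsf{U}$ is a non-empty set with a partial order $\preceq_{\mathrm{p}}$ and a commutative associative binary operation $\oplus\colon\mathsf{U}\times\mathsf{U}\to\mathsf{U}$ (called addition). A total order $\preceq$ on $\mathsf{U}$ is an admissible order w.r.t. $\preceq_{\mathrm{p}}$ if $\mathbf{x}\preceq_{\mathrm{p}}\mathbf{z}$ implies $\mathbf{x}\preceq\mathbf{z}$; $\preceq$ is such an order, and $\mathbf{x}\prec\mathbf{z}$ means $\mathbf{x}\preceq\mathbf{z}$ and $\mathbf{x}\ne\mathbf{z}$. $\mathsf{K}\subseteq\mathsf{U}$ is a non-empty set having a least element $\mathbf{0}$ and a greatest element $\mathbf{1}$ w.r.t. $\preceq_{\mathrm{p}}$ (both in $\mathsf{K}$), with $\mathbf{0}\preceq_{\mathrm{p}}\mathbf{1}$ and $\mathbf{0}\ne\mathbf{1}$. $\prec$ is compatible with $\oplus$ if $\mathbf{x}_1\prec\mathbf{x}_2$ implies $\mathbf{x}_1\oplus\mathbf{v}\prec\mathbf{x}_2\oplus\mathbf{v}$ for all $\mathbf{x}_1,\mathbf{x}_2,\mathbf{v}\in\mathsf{U}$. $[n]=\{1,\dots,n\}$. $\mathbf{M}$ is the set of capacities on $[n]$: $\mu\colon 2^{[n]}\to[0,1]$ with $\mu(C)\le\mu(D)$ for $C\subset D$, $\mu(\varnothing)=0$, $\mu([n])=1$. For $\mathbf{X},\mathbf{Z}\in\mathsf{U}^n$, $\mathbf{X}\preceq_{(n)}\mathbf{Z}$ means $\mathbf{x}_i\preceq\mathbf{z}_i$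 for all $i\in[n]$. For $\mathbf{X}=(\mathbf{x}_1,\dots,\mathbf{x}_n)\in\mathsf{K}^n$, $\Pi_{\mathbf{X}}$ is the set of permutations $\sigma$ of $[n]$ with $\mathbf{x}_{\sigma(1)}\preceq\dots\preceq\mathbf{x}_{\sigma(n)}$. The $\mathcal{C}_{\preceq}$-operator is $\mathcal{C}_{\preceq,\sigma,\mathsf{L}}(\mathbf{X},\mu)=\bigoplus_{i=1}^n \mathsf{L}(\mathbf{x}_{\sigma(i)},\mathbf{x}_{\sigma(i-1)},\mu(B_{\sigma(i)}),\mu(B_{\sigma(i+1)}))$ for $\sigma\in\Pi_{\mathbf{X}}$, with $\mathbf{x}_{\sigma(0)}=\mathbf{0}$, $B_{\sigma(i)}=\{\sigma(i),\dots,\sigma(n)\}$ for $i\in[n]$, $B_{\sigma(n+1)}=\varnothing$. It is well defined if, for every $\mathbf{X}\in\mathsf{K}^n$ and $\mu\in\mathbf{M}$, the value is the same for all $\sigma\in\Pi_{\mathbf{X}}$. For $\mathbf{u},\mathbf{v}\in\mathsf{U}$, $[\mathbf{u},\mathbf{v}]_{\mathsf{K}}=\{\mathbf{x}\in\mathsf{K}:\mathbf{u}\preceq\mathbf{x}\preceq\mathbf{v}\}$. A function $\mathsf{H}\colon\mathsf{K}_0\to\mathsf{U}$ with $\mathsf{K}_0\subseteq\mathsf{K}$ is non-decreasing w.r.t. $\preceq$ if $\mathbf{x}_1\preceq\mathbf{x}_2$ implies $\mathsf{H}(\mathbf{x}_1)\preceq\mathsf{H}(\mathbf{x}_2)$.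 *)

(* Defs.v *)
From HB Require Import structures.
From mathcomp Require Import all_boot all_order all_algebra all_fingroup.
From mathcomp Require Import reals.
From Stdlib Require Relation_Definitions.

Set Implicit Arguments.
Unset Strict Implicit.
Unset Printing Implicit Defensive.

Import Order.TTheory GRing.Theory Num.Theory.

Local Open Scope ring_scope.

Definition partial_order (U : Type) (r : U -> U -> Prop) : Prop :=
  Relation_Definitions.order U r.

Record admissible_order (U : Type) (le_p le : U -> U -> Prop) : Prop :=
  AdmissibleOrder {
    admissible_order_partial : partial_order le;
    admissible_order_total : forall x z : U, le x z \/ le z x;
    admissible_order_extends : forall x z : U, le_p x z -> le x z
  }.

Definition strict (U : Type) (le : U -> U -> Prop) (x z : U) : Prop :=
  le x z /\ x <> z.

Definition lt_compatible (U : Type) (le : U -> U -> Prop) (op : U -> U -> U) :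
    Prop :=
  forall x1 x2 v : U, strict le x1 x2 -> strict le (op x1 v) (op x2 v).

Definition is_least (U : Type) (le_p : U -> U -> Prop) (K : U -> Prop)
    (x : U) : Prop :=
  K x /\ forall y : U, K y -> le_p x y.

Definition is_greatest (U : Type) (le_p : U -> U -> Prop) (K : U -> Prop)
    (x : U) : Prop :=
  K x /\ forall y : U, K y -> le_p y x.

Definition interval_in (U : Type) (le : U -> U -> Prop) (K : U -> Prop)
    (u v x : U) : Prop :=
  [/\ K x, le u x & le x v].

Definition nondecreasing_on (U : Type) (le : U -> U -> Prop) (D : U -> Prop)
    (H : U -> U) : Prop :=
  forall x1 x2 : U, D x1 -> D x2 -> le x1 x2 -> le (H x1) (H x2).

Record capacity (R : realType) (n : nat) (mu : {set 'I_n} -> R) : Prop :=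
  Capacity {
    capacity_range : forall C : {set 'I_n}, 0 <= mu C <= 1;
    capacity_mono : forall C D : {set 'I_n}, C \subset D -> mu C <= mu D;
    capacity_set0 : mu set0 = 0;
    capacity_setT : mu [set: 'I_n] = 1
  }.

(* A function [K^2 x [0,1]^2 -> K] is encoded as a total function that maps
   this domain into [K]; its values elsewhere are never used. *)
Definition maps_into (R : realType) (U : Type) (K : U -> Prop)
    (L : U -> U -> R -> R -> U) : Prop :=
  forall (x y : U) (a b : R), K x -> K y -> 0 <= a <= 1 -> 0 <= b <= 1 ->
    K (L x y a b).

Definition vec_in (U : Type) (K : U -> Prop) (n : nat) (X : 'I_n -> U) : Prop :=
  forall i : 'I_n, K (X i).

Definition vec_le (U : Type) (le : U -> U -> Prop) (n : nat)
    (X Z : 'I_n -> U) : Prop :=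
  forall i : 'I_n, le (X i) (Z i).

(* [sorting_perm le X s] is the membership of [s] in [Pi_X]. *)
Definition sorting_perm (U : Type) (le : U -> U -> Prop) (n : nat)
    (X : 'I_n -> U) (s : {perm 'I_n}) : Prop :=
  forall i j : 'I_n, (j = i.+1 :> nat) -> le (X (s i)) (X (s j)).

(* Positions are numbered from 0, so [upper_set s i] is [B_{s(i+1)}];
   it is empty for [i = n]. *)
Definition upper_set (n : nat) (s : {perm 'I_n}) (i : nat) : {set 'I_n} :=
  [set s j | j : 'I_n & (i <= j)%N].

(* The addition has no neutral element, so the dimension is [n.+1] and the
   iterated addition starts from the first term. *)
Section COperator.
Variables (R : realType) (U : Type) (op : U -> U -> U) (zero : U).
Variables (L : U -> U -> R -> R -> U) (n : nat).

Definition C_term (s : {perm 'I_n.+1}) (X : 'I_n.+1 -> U)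
    (mu : {set 'I_n.+1} -> R) (i : nat) : U :=
  L (X (s (inord i))) (if i is j.+1 then X (s (inord j)) else zero)
    (mu (upper_set s i)) (mu (upper_set s i.+1)).

Definition C_operator (s : {perm 'I_n.+1}) (X : 'I_n.+1 -> U)
    (mu : {set 'I_n.+1} -> R) : U :=
  iteri n (fun i acc => op acc (C_term s X mu i.+1)) (C_term s X mu 0).

Definition C_well_defined (le : U -> U -> Prop) (K : U -> Prop) : Prop :=
  forall (X : 'I_n.+1 -> U) (mu : {set 'I_n.+1} -> R),
    vec_in K X -> capacity mu ->
    forall s t : {perm 'I_n.+1}, sorting_perm le X s -> sorting_perm le X t ->
      C_operator s X mu = C_operator t X mu.

Definition C_monotone (le : U -> U -> Prop) (K : U -> Prop) : Prop :=
  forall X Z : 'I_n.+1 -> U, vec_in K X -> vec_in K Z -> vec_le le X Z ->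
    forall (s t : {perm 'I_n.+1}) (mu : {set 'I_n.+1} -> R),
      sorting_perm le X s -> sorting_perm le Z t -> capacity mu ->
      le (C_operator s X mu) (C_operator t Z mu).

End COperator.
Arguments C_well_defined {R U} op zero L n le K.
Arguments C_monotone {R U} op zero L n le K.

(* Main.v *)
Require Import Defs.
From HB Require Import structures.
From mathcomp Require Import all_boot all_order all_algebra all_fingroup.
From mathcomp Require Import reals.

Import Order.TTheory GRing.Theory Num.Theory.

Local Open Scope ring_scope.

(** Sorting [(x, y)] with [x <= y] gives the value
    [L(x, 0, 1, b) (+) L(y, x, b, 0)], where [b] is the capacity of the index
    carrying [y].  By (c), and then (b), this value grows when first [y] and
    then [x] is raised, which settles vectors sorted by the same permutation.
    If the permutations differ, then [x_i <= x_j <= z_j <= z_i], so the constant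
    vector [(x_j, x_j)] lies between [X] and [Z] and is sorted by both
    permutations; well-definedness identifies its two values.  Conversely (c)
    needs cancellation, which strict compatibility and totality provide. *)

(** By totality a failure would mean [x2] strictly below [x1]; compatibility makes the sums strictly
    ordered the same way, against antisymmetry. *)
Lemma lt_compatible_cancel (U : Type) (le : U -> U -> Prop) (op : U -> U -> U) :
  partial_order le -> (forall x z : U, le x z \/ le z x) ->
  lt_compatible le op ->
  forall x1 x2 v : U, le (op x1 v) (op x2 v) -> le x1 x2.
Proof.
move=> [refl _ anti] total compat x1 x2 v le_op.
have [//|le21] := total x1 x2.
have [->|neq21] := boolp.pselect (x2 = x1); first exact: refl.
have [le_op' neq_op] := compat x2 x1 v (conj le21 neq21).
by case: neq_op; apply: anti.
Qed.

Lemma sorting_perm2 (U : Type) (le : U -> U -> Prop) (X : 'I_2 -> U)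
    (s : {perm 'I_2}) :
  sorting_perm le X s <-> le (X (s ord0)) (X (s ord_max)).
Proof.
split=> [sorted_s|le_s i j eq_ij]; first exact: sorted_s.
have ltj := ltn_ord j; rewrite eq_ij !ltnS leqn0 in ltj.
have -> : i = ord0 by apply: val_inj; rewrite /= (eqP ltj).
by have -> : j = ord_max by apply: val_inj; rewrite /= eq_ij (eqP ltj).
Qed.

Lemma perm2_neq (s t : {perm 'I_2}) :
  s <> t -> t ord0 = s ord_max /\ t ord_max = s ord0.
Proof.
(* With only two indices, any two that avoid a third one coincide. *)
have two (i j k : 'I_2) : i != k -> j != k -> i = j.
  by case: i j k => [[|[|i]] ?] [[|[|j]] ?] [[|[|k]] ?] //= _ _; apply: val_inj.
have neq01 (r : {perm 'I_2}) : r ord0 != r ord_max by rewrite (inj_eq perm_inj).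
move=> neq_st; have neq0 : t ord0 != s ord0.
  apply/eqP => eq0; apply: neq_st; apply/permP => i.
  have [->|neqi] := eqVneq i ord0; first by rewrite eq0.
  by apply: (two _ _ (s ord0)); [|rewrite -eq0]; rewrite (inj_eq perm_inj).
split; first by apply: (two _ _ (s ord0)) => //; rewrite eq_sym neq01.
by apply: (two _ _ (t ord0)); rewrite eq_sym ?neq01.
Qed.

(** The sets [upper_set s i] for [i = 0, 1, 2] are the full set, a singleton and the empty set, so a
    single free capacity value survives. *)
Lemma C_operator2 (R : realType) (U : Type) (op : U -> U -> U) (zero : U)
    (L : U -> U -> R -> R -> U) (s : {perm 'I_2}) (X : 'I_2 -> U)
    (mu : {set 'I_2} -> R) :
  capacity mu ->
  C_operator op zero L s X mu =
    op (L (X (s ord0)) zero 1 (mu [set s ord_max]))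
       (L (X (s ord_max)) (X (s ord0)) (mu [set s ord_max]) 0).
Proof.
move=> [_ _ mu0 muT]; rewrite /C_operator /C_term /=.
have -> : inord 0 = ord0 :> 'I_2 by apply: val_inj; rewrite /= inordK.
have -> : inord 1 = ord_max :> 'I_2 by apply: val_inj; rewrite /= inordK.
have -> : upper_set s 0 = setT.
  apply/setP => x; rewrite inE; apply/imsetP.
  by exists ((s^-1)%g x); rewrite ?inE ?permKV.
have -> : upper_set s 1 = [set s ord_max].
  apply/setP => x; rewrite inE; apply/imsetP/eqP => [[j]|->].
    rewrite inE => gtj ->; congr (s _); apply: val_inj.
    by apply/eqP; rewrite eqn_leq -ltnS ltn_ord.
  by exists ord_max; rewrite ?inE.
have -> : upper_set s 2 = set0.
  apply/setP => x; rewrite inE; apply/imsetP => -[j].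
  by rewrite inE leqNgt ltn_ord.
by rewrite mu0 muT.
Qed.

(** Realises an arbitrary [b] in the unit interval as the capacity of every singleton of ['I_2]. *)
Definition const_capacity (R : realType) (n : nat) (b : R) (C : {set 'I_n}) : R :=
  if C == set0 then 0 else if C == setT then 1 else b.
Arguments const_capacity {R n} b C.

Lemma const_capacityP (R : realType) (n : nat) (b : R) :
  0 <= b <= 1 -> capacity (@const_capacity R n.+1 b).
Proof.
move=> /andP[b0 b1]; have neqT0 : [set: 'I_n.+1] != set0.
  by apply/set0Pn; exists ord0; rewrite inE.
rewrite /const_capacity; split=> [C|C D sCD||].
- by case: ifP => _; [|case: ifP => _]; rewrite ?lexx ?ler01 ?b0.
- have [C0|C0] := eqVneq C set0.
    by case: ifP => _; [|case: ifP => _]; rewrite ?lexx ?ler01.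
  have [D0|D0] := eqVneq D set0; first by rewrite D0 subset0 (negPf C0) in sCD.
  have [CT|CT] := eqVneq C setT; first by rewrite -subTset -CT sCD lexx.
  by case: ifP.
- by rewrite eqxx.
- by rewrite (negPf neqT0) eqxx.
Qed.

Lemma const_capacity1 (R : realType) (b : R) (i : 'I_2) :
  const_capacity b [set i] = b.
Proof.
rewrite /const_capacity -cards_eq0 cards1 /=.
by rewrite eqEcard cards1 cardsT card_ord andbF.
Qed.

(** Monotonicity tested on [const_capacity b] and vectors already sorted by the identity; (b) is the
    case [y = y'] and (c) comes from [x = x']. *)
Lemma C_monotone2_sorted (R : realType) (U : Type) (le : U -> U -> Prop)
    (op : U -> U -> U) (K : U -> Prop) (zero : U)
    (L : U -> U -> R -> R -> U) (x y x' y' : U) (b : R) :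
  C_monotone op zero L 1 le K -> 0 <= b <= 1 ->
  K x -> K y -> K x' -> K y' ->
  le x y -> le x' y' -> le x x' -> le y y' ->
  le (op (L x zero 1 b) (L y x b 0)) (op (L x' zero 1 b) (L y' x' b 0)).
Proof.
move=> mono b01 Kx Ky Kx' Ky' lexy lexy' lexx leyy.
pose V (p q : U) (i : 'I_2) := if i == ord0 then p else q.
have cap := const_capacityP R 1 b b01.
have := mono (V x y) (V x' y') _ _ _ 1%g 1%g _ _ _ cap.
rewrite !C_operator2 // !const_capacity1 !perm1 /V /=; apply.
- by move=> i; case: ifP.
- by move=> i; case: ifP.
- by move=> i; case: ifP.
- by apply/sorting_perm2; rewrite !perm1.
- by apply/sorting_perm2; rewrite !perm1.
Qed.

(* The dimension 2 is [n.+1] with [n := 1]. *)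
Theorem theorem3p6 (R : realType) (U : Type) (le_p le : U -> U -> Prop)
    (op : U -> U -> U) (K : U -> Prop) (zero one : U)
    (L : U -> U -> R -> R -> U)
    (hle_p : partial_order le_p)
    (hopC : commutative op) (hopA : associative op)
    (hle : admissible_order le_p le)
    (hzero : is_least le_p K zero) (hone : is_greatest le_p K one)
    (hzero_one : zero <> one)
    (hL : maps_into K L)
    (hlt : lt_compatible le op) :
  C_monotone op zero L 1 le K <->
  [/\ C_well_defined op zero L 1 le K,
      (forall (v : U) (b : R), K v -> 0 <= b <= 1 ->
         nondecreasing_on le (interval_in le K zero v)
           (fun x => op (L x zero 1 b) (L v x b 0))) &
      (forall (u : U) (b : R), K u -> 0 <= b <= 1 ->
         nondecreasing_on le (interval_in le K u one)
           (fun x => L x u b 0))].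

Proof.
have [[refl trans anti] total ext] := hle.
have [[K0 min0] [K1 max1]] := (hzero, hone).
have le0 x : K x -> le zero x by move=> Kx; apply/ext/min0.
have le1 x : K x -> le x one by move=> Kx; apply/ext/max1.
have cancel := lt_compatible_cancel _ _ _ (admissible_order_partial hle) total hlt.
have compat x1 x2 v : le x1 x2 -> le (op x1 v) (op x2 v).
  move=> le12; have [->|neq12] := boolp.pselect (x1 = x2); first exact: refl.
  by have [] := hlt x1 x2 v (conj le12 neq12).
split=> [mono|[wd mono_lo mono_hi]].
  split.
  - move=> X mu KX cap s t sX tX.
    (* Monotonicity is applied to [X] and itself, in both directions. *)
    by apply: anti; apply: mono => // i; apply: refl.
  - move=> v b Kv b01 x1 x2 [Kx1 _ lex1] [Kx2 _ lex2] le12.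
    by apply: (C_monotone2_sorted R U le op K) => //; auto.
  - move=> u b Ku b01 x1 x2 [Kx1 lex1 _] [Kx2 lex2 _] le12.
    (* The cancelled term is the first summand, common to the vectors [(u, x1)] and [(u, x2)]. *)
    apply: (cancel _ _ (L u zero 1 b)); rewrite ![op _ (L u _ _ _)]hopC.
    by apply: (C_monotone2_sorted R U le op K) => //; auto.
have mono_same (X Z : 'I_2 -> U) s mu : vec_in K X -> vec_in K Z -> vec_le le X Z ->
    sorting_perm le X s -> sorting_perm le Z s -> capacity mu ->
    le (C_operator op zero L s X mu) (C_operator op zero L s Z mu).
  move=> KX KZ leXZ /sorting_perm2 sX /sorting_perm2 sZ cap.
  rewrite !C_operator2 //; set b := mu _.
  have b01 : 0 <= b <= 1 by exact: capacity_range cap _.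
  have le_s : le (X (s ord0)) (Z (s ord_max)) by exact: trans sX (leXZ _).
  (* The intermediate value belongs to the vector with smaller entry from [X] and larger entry from
     [Z], which [le_s] keeps sorted. *)
  apply: (trans _ (op (L (X (s ord0)) zero 1 b)
                      (L (Z (s ord_max)) (X (s ord0)) b 0))).
    rewrite ![op (L _ zero _ _) _]hopC; apply: compat.
    by apply: (mono_hi _ b) => //; split=> //; apply: le1.
  by apply: (mono_lo _ b) => //; split=> //; apply: le0.
move=> X Z KX KZ leXZ s t mu sX tZ cap.
have [eq_st|neq_st] := boolp.pselect (s = t).
  by rewrite -eq_st in tZ *; apply: mono_same.
have [t0 t1] := perm2_neq _ _ neq_st.
have two (i : 'I_2) : i = s ord0 \/ i = s ord_max.
  rewrite -[i](permKV s); case: ((s^-1)%g i) => [[|[|k]] ltk] //.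
    by left; congr (s _); apply: val_inj.
  by right; congr (s _); apply: val_inj.
have /sorting_perm2 leX := sX.
(* Since [t] swaps the two positions of [s], the larger entry of [Z] sits at index [s ord0]. *)
have /sorting_perm2 := tZ; rewrite t0 t1 => leZ.
pose Y (_ : 'I_2) := X (s ord_max).
have KY : vec_in K Y by move=> i; apply: KX.
have sorted_Y r : sorting_perm le Y r by apply/sorting_perm2; apply: refl.
have leXY : vec_le le X Y by move=> i; have [->|->] := two i; [|apply: refl].
have leYZ : vec_le le Y Z.
  by move=> i; have [->|->] := two i; [apply: trans leZ|]; apply: leXZ.
apply: (trans _ (C_operator op zero L s Y mu)); first exact: mono_same.
(* On the constant [Y], (a) trades [s] for [t], which also sorts [Z]. *)
by rewrite (wd Y mu KY cap s t) //; apply: mono_same.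
Qed.
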